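(* Let $(\mathcal A,\bullet,\omega)$ be a symplectic left (resp. right) Leibniz algebra. Then $(\mathcal A,\star_l)$ (resp. $(\mathcal A,\star_r)$) is a left symmetric algebra, where $$u\star_lv=-\mathrm L_u^*v,\qquad u\star_rv=-\mathrm R_u^*v,\qquad u,v\in\mathcal A.$$ In particular, $(\mathcal A,\bullet)$ is Lie-admissible.
   Context: All algebras are finite-dimensional over a field $\mathbb K$ of characteristic $0$. For an algebra $(\mathcal A,\bullet)$: $\mathrm L_uv=u\bullet v$, $\mathrm R_uv=v\bullet u$, $[u,v]=\frac12(u\bullet v-v\bullet u)$. It is left Leibniz if $\mathrm L_{u\bullet v}=[\mathrm L_u,\mathrm L_v]$ for all $u,v$, and right Leibniz if $\mathrm R_{w\bullet u}=-[\mathrm R_w,\mathrm R_u]$ for all $u,w$. A symplectic left Leibniz algebra is a left Leibniz algebra with a nondegenerate skew-symmetric bilinear form $\omega$ such that $\mathrm L_v^*u-\mathrm L_u^*v=[u,v]$ for all $u,v$; a symplectic right Leibniz algebra is a right Leibniz algebra with a nondegenerate skew-symmetric bilinear form $\omega$ such that $\mathrm R_v^*u-\mathrm R_u^*v=-[u,v]$ for all $u,v$. Here $^*$ is the adjoint with respect to $\omega$: $\omega(Tu,v)=\omega(u,T^*v)$. An algebra $(\mathcal A,\star)$ is left symmetric if $\mathrm{ass}(u,v,w)=\mathrm{ass}(v,u,w)$ with $\mathrm{ass}(u,v,w)=(u\star v)\star w-u\star(v\star w)$. An algebra $(\mathcal A,\bullet)$ is Lie-admissible if $[u,v]=\frac12(u\bullet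 v-v\bullet u)$ is a Lie bracket. *)

(* Defs.v *)
From HB Require Import structures.
From mathcomp Require Import all_boot all_algebra.

Set Implicit Arguments.
Unset Strict Implicit.
Unset Printing Implicit Defensive.

Import GRing.Theory.
Local Open Scope ring_scope.

Section Algebra.
Variables (K : fieldType) (A : vectType K).

Definition lmul (mul : {bilinear A -> A -> A}) (u : A) : 'End(A) :=
  linfun (fun v => mul u v).

Definition rmul (mul : {bilinear A -> A -> A}) (u : A) : 'End(A) :=
  linfun (fun v => mul v u).

Lemma lmulE (mul : {bilinear A -> A -> A}) u v : lmul mul u v = mul u v.
Proof. exact: (lfunE (mul u)). Qed.

Lemma rmulE (mul : {bilinear A -> A -> A}) u v : rmul mul u v = mul v u.
Proof. exact: (lfunE (applyr mul u)). Qed.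

(* The bracket of two elements of A carries a factor 1/2; the bracket of two
   endomorphisms is the plain commutator. *)
Definition half_bracket (mul : A -> A -> A) (u v : A) : A :=
  (2%:R : K)^-1 *: (mul u v - mul v u).

Definition commutator (f g : 'End(A)) : 'End(A) := (f \o g)%VF - (g \o f)%VF.

Definition left_leibniz (mul : {bilinear A -> A -> A}) : Prop :=
  forall u v, lmul mul (mul u v) = commutator (lmul mul u) (lmul mul v).

Definition right_leibniz (mul : {bilinear A -> A -> A}) : Prop :=
  forall u w, rmul mul (mul w u) = - commutator (rmul mul w) (rmul mul u).

Definition is_bilinear (mul : A -> A -> A) : Prop :=
  (forall v, linear (mul^~ v)) /\ (forall u, linear (mul u)).

Definition associator (mul : A -> A -> A) (u v w : A) : A :=
  mul (mul u v) w - mul u (mul v w).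

Definition left_symmetric_algebra (star : A -> A -> A) : Prop :=
  is_bilinear star /\
  forall u v w, associator star u v w = associator star v u w.

Definition lie_bracket (br : A -> A -> A) : Prop :=
  [/\ is_bilinear br,
      forall u, br u u = 0 &
      forall u v w, br u (br v w) + br v (br w u) + br w (br u v) = 0].

Definition lie_admissible (mul : A -> A -> A) : Prop :=
  lie_bracket (half_bracket mul).

Section Symplectic.
Variable omega : {skew_symmetric A}.

Definition flat : 'Hom(A, 'Hom(A, K^o)) :=
  linfun (fun v => linfun (fun u => omega u v : K^o)).

(* flat v is the linear form omega(-, v), so flat (T^* v) = flat v \o T is the
   defining property of the adjoint; see adjointP and adjoint_uniq. The value
   is meaningful only when omega is nondegenerate, i.e. flat is invertible. *)
Definition adjoint (T : 'End(A)) : 'End(A) :=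
  linfun (fun v => (flat^-1)%VF (flat v \o T)%VF).

Let form_lin v : linear (fun u => omega u v : K^o).
Proof. by move=> a x y; exact: linearPl. Qed.

Let formE v u : linfun (fun u => omega u v : K^o) u = omega u v.
Proof.
pose f : {linear A -> K^o} :=
  HB.pack (fun u => omega u v : K^o) (GRing.isLinear.Build _ _ _ _ _ (form_lin v)).
exact: (lfunE f).
Qed.

Let flat_lin : linear (fun v => linfun (fun u => omega u v : K^o)).
Proof.
move=> a x y; apply/lfunP => u.
by rewrite add_lfunE scale_lfunE !formE linearDr /= linearZr_LR.
Qed.

Lemma flatE v u : flat v u = omega u v.
Proof.
pose f : {linear A -> 'Hom(A, K^o)} :=
  HB.pack (fun v => linfun (fun u => omega u v : K^o))
    (GRing.isLinear.Build _ _ _ _ _ flat_lin).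
by rewrite -(formE v u); congr (fun_of_lfun _ u); exact: (lfunE f).
Qed.

Hypothesis omega_nondeg : nondegenerate omega.

Lemma flat_inj v : (forall u, omega u v = 0) -> v = 0.
Proof.
move=> v0; apply/eqP; rewrite -memv0 -(eqP omega_nondeg).
apply/(@mem_orthovP _ _ _ _ omega) => u _.
by rewrite (@hermC _ _ _ _ omega) /= v0 mulr0.
Qed.

Lemma flat_surj (f : 'Hom(A, K^o)) : flat ((flat^-1)%VF f) = f.
Proof.
have ker0 : lker flat == 0%VS.
  apply/lker0P => x y exy; apply/eqP; rewrite -subr_eq0; apply/eqP.
  by apply: flat_inj => u; rewrite -flatE linearB /= exy subrr zero_lfunE.
apply: limg_lfunVK; suff -> : limg flat = fullv by rewrite memvf.
apply/eqP; rewrite eqEdim subvf limg_dim_eq ?(eqP ker0) ?capv0 //.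
by rewrite !dimvf /dim /= muln1.
Qed.

Lemma adjointP (T : 'End(A)) u v : omega (T u) v = omega u (adjoint T v).
Proof.
have lin : linear (fun v => (flat^-1)%VF (flat v \o T)%VF).
  move=> a x y; rewrite -linearP /=; congr (_ _).
  by apply/lfunP => w; rewrite !lfun_simp linearP /= !lfun_simp.
pose f : {linear A -> A} :=
  HB.pack (fun v => (flat^-1)%VF (flat v \o T)%VF)
    (GRing.isLinear.Build _ _ _ _ _ lin).
have -> : adjoint T v = (flat^-1)%VF (flat v \o T)%VF by exact: (lfunE f).
by rewrite -[RHS]flatE flat_surj comp_lfunE flatE.
Qed.

Lemma adjoint_uniq (T S : 'End(A)) :
  (forall u v, omega (T u) v = omega u (S v)) -> S = adjoint T.
Proof.
move=> TS; apply/lfunP => v; apply/eqP; rewrite -subr_eq0; apply/eqP.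
by apply: flat_inj => u; rewrite linearBr /= -TS adjointP subrr.
Qed.

End Symplectic.

Definition symplectic_left_leibniz
    (mul : {bilinear A -> A -> A}) (omega : {skew_symmetric A}) : Prop :=
  [/\ left_leibniz mul,
      nondegenerate omega &
      forall u v, adjoint omega (lmul mul v) u - adjoint omega (lmul mul u) v
                  = half_bracket mul u v].

Definition symplectic_right_leibniz
    (mul : {bilinear A -> A -> A}) (omega : {skew_symmetric A}) : Prop :=
  [/\ right_leibniz mul,
      nondegenerate omega &
      forall u v, adjoint omega (rmul mul v) u - adjoint omega (rmul mul u) v
                  = - half_bracket mul u v].

Definition star_l (mul : {bilinear A -> A -> A}) (omega : {skew_symmetric A})
  (u v : A) : A := - adjoint omega (lmul mul u) v.

Definition star_r (mul : {bilinear A -> A -> A}) (omega : {skew_symmetric A})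
  (u v : A) : A := - adjoint omega (rmul mul u) v.

End Algebra.

(* Main.v *)
Require Import Defs.
From HB Require Import structures.
From mathcomp Require Import all_boot all_algebra.

(** Polarising the Leibniz identity gives [T_[u,v] = ± [T_u, T_v]] for [T] the
    left (resp. right) multiplication. Since taking adjoints reverses products,
    [S_u = - T_u^*] satisfies [S_[u,v] = ± [S_u, S_v]] with the same sign, and
    the symplectic condition reads [S_u v - S_v u = ± [u, v]], again with that
    sign. Hence [S_(S_u v - S_v u) = [S_u, S_v]], which is left symmetry of
    [u * v = S_u v]; and [[u, v]], being up to sign the commutator of a
    left symmetric product, is a Lie bracket. *)

Import GRing.Theory.
Local Open Scope ring_scope.

Section LeftSymmetric.
Variables (K : fieldType) (A : vectType K).
Implicit Types (mul : {bilinear A -> A -> A}) (omega : {skew_symmetric A}).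

Lemma lmul_linear mul : linear (lmul mul).
Proof.
move=> a x y; apply/lfunP => v.
by rewrite add_lfunE scale_lfunE !lmulE linearPl.
Qed.

Lemma rmul_linear mul : linear (rmul mul).
Proof.
move=> a x y; apply/lfunP => v.
by rewrite add_lfunE scale_lfunE !rmulE linearPr.
Qed.

(** By uniqueness of the adjoint, it suffices that the combination of adjoints satisfies the
    defining identity. *)
Lemma adjoint_linear omega : nondegenerate omega -> linear (adjoint omega).
Proof.
move=> nd a S T; apply/esym/adjoint_uniq => // u v.
by rewrite !add_lfunE !scale_lfunE linearPl linearPr /= -!adjointP.
Qed.

Lemma adjoint_commutator omega (S T : 'End(A)) : nondegenerate omega ->
  adjoint omega (commutator S T)
  = commutator (adjoint omega T) (adjoint omega S).
Proof.
move=> nd; apply/esym/adjoint_uniq => // u v.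
rewrite /commutator !add_lfunE !opp_lfunE !comp_lfunE.
by rewrite linearBl linearBr /= -!adjointP.
Qed.

(** Since $u * v = S_u v$, the difference ass(u,v,w) - ass(v,u,w) equals $S_{S_u v - S_v u} w -
    [S_u, S_v] w$. *)
Lemma left_symmetric_of_left_mul (star : A -> A -> A) (S : A -> 'End(A)) :
    (forall u v, star u v = S u v) -> linear S ->
    (forall u v, S (S u v - S v u) = commutator (S u) (S v)) ->
  left_symmetric_algebra star.
Proof.
move=> starE linS SC; split.
  split=> [v a x y | u a x y]; rewrite !starE; last exact: linearP.
  by rewrite linS add_lfunE scale_lfunE.
have SB x y : S (x - y) = S x - S y.
  by rewrite addrC -scaleN1r linS scaleN1r addrC.
move=> u v w; rewrite /associator !starE.
have /lfunP/(_ w) := SC u v.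
rewrite SB /commutator !add_lfunE !opp_lfunE !comp_lfunE => /eqP.
by rewrite subr_eq => /eqP ->; rewrite addrAC [_ - _ - _]addrAC subrr sub0r addrC.
Qed.

(* The sign [e] is [1] for left and [-1] for right multiplications. *)
Lemma left_symmetric_adjoint omega mul (T : A -> 'End(A)) (e : K) :
    (2%:R : K) != 0 -> e * e = 1 -> nondegenerate omega -> linear T ->
    (forall u v, T (mul u v) = e *: commutator (T u) (T v)) ->
    (forall u v, adjoint omega (T v) u - adjoint omega (T u) v
                 = e *: half_bracket mul u v) ->
  left_symmetric_algebra (fun u v => - adjoint omega (T u) v).
Proof.
move=> two_neq0 ee nd linT TM Tsymp.
pose S x : 'End(A) := - adjoint omega (T x).
apply: (@left_symmetric_of_left_mul _ S) => [u v | a x y | u v].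
- by rewrite opp_lfunE.
- by rewrite /S linT adjoint_linear // opprD scalerN.
have TB x y : T (x - y) = T x - T y.
  by rewrite addrC -scaleN1r linT scaleN1r addrC.
have TZ a x : T (a *: x) = a *: T x.
  have T0 : T 0 = 0 by rewrite -(subrr 0) TB subrr.
  by rewrite -[a *: x]addr0 linT T0 addr0.
have -> : S u v - S v u = e *: half_bracket mul u v.
  by rewrite -Tsymp /S !opp_lfunE opprK addrC.
(* The two commutators are opposite, so their difference is twice the first: this cancels the 1/2,
   and [e * e = 1] absorbs the signs. *)
have TC : T (e *: half_bracket mul u v) = commutator (T u) (T v).
  rewrite TZ /half_bracket TZ TB !TM -scalerBr.
  have -> : commutator (T v) (T u) = - commutator (T u) (T v).
    by rewrite /commutator opprB.
  rewrite opprK -mulr2n -scaler_nat !scalerA.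
  by rewrite mulrACA ee mul1r mulVf // scale1r.
(* Here $-[T_u, T_v]^* = [T_u^*, T_v^*] = [S_u, S_v]$. *)
rewrite /S TC adjoint_commutator // /commutator opprB.
by rewrite !comp_lfunNl !comp_lfunNr !opprK.
Qed.

(** Only the Jacobi identity uses left symmetry; [c] allows for the sign in the right-handed
    case. *)
Lemma lie_bracket_left_symmetric (star br : A -> A -> A) (c : K) :
    left_symmetric_algebra star ->
    (forall u v, br u v = c *: (star u v - star v u)) ->
  lie_bracket br.
Proof.
move=> [[linl linr] ass] brE.
have starBl x y z : star (x - y) z = star x z - star y z.
  by rewrite addrC -scaleN1r linl scaleN1r addrC.
have starBr x y z : star x (y - z) = star x y - star x z.
  by rewrite addrC -scaleN1r linr scaleN1r addrC.
have star0l z : star 0 z = 0 by rewrite -(subrr 0) starBl !subrr.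
have star0r z : star z 0 = 0 by rewrite -(subrr 0) starBr !subrr.
have starZl a x z : star (a *: x) z = a *: star x z.
  by rewrite -[a *: x]addr0 linl star0l addr0.
have starZr a x z : star z (a *: x) = a *: star z x.
  by rewrite -[a *: x]addr0 linr star0r addr0.
split.
- split=> [v a x y | u a x y]; rewrite !brE linl linr opprD addrACA.
    by rewrite -scalerBr scalerDr !scalerA mulrC.
  by rewrite -scalerBr scalerDr !scalerA mulrC.
- by move=> u; rewrite brE subrr scaler0.
move=> u v w; rewrite !brE !starZl !starZr -!scalerBr -!scalerDr.
rewrite !starBl !starBr.
(* Left symmetry solved for $(y * x) * z$: only [p], [q], [r] remain as left-nested products, and
   each cancels within its own double bracket. *)
have swap x y z :
    star (star y x) z = star (star x y) z - star x (star y z) + star y (star x z).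
  by apply/eqP; rewrite -subr_eq; apply/eqP/esym/ass.
rewrite (swap u v w) (swap v w u) (swap w u v).
set a1 := star u (star v w); set a2 := star v (star u w).
set b1 := star v (star w u); set b2 := star w (star v u).
set c1 := star w (star u v); set c2 := star u (star w v).
set p := star (star u v) w; set q := star (star v w) u.
set r := star (star w u) v.
have cancel (x y z : A) : x - (x - y + z) = y - z.
  by rewrite opprD opprB addrA [x + _]addrC subrK.
rewrite !cancel !opprB !addrA.
(* Each of the six right-nested products occurs twice, with opposite signs; the permutation pairs
   them. *)
rewrite [X in c *: (c *: X)](ACl (1*12*(2*7)*(3*10)*(4*5)*(6*11)*(8*9)))/=.
by rewrite !subrr !addNr !addr0 !scaler0.
Qed.

End LeftSymmetric.

Theorem proposition2p3 (K : fieldType) (charK0 : [pchar K] =i pred0)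
    (A : vectType K) (mul : {bilinear A -> A -> A}) (omega : {skew_symmetric A}) :
  (symplectic_left_leibniz mul omega ->
     left_symmetric_algebra (star_l mul omega) /\ lie_admissible mul) /\
  (symplectic_right_leibniz mul omega ->
     left_symmetric_algebra (star_r mul omega) /\ lie_admissible mul).
Proof.
have two_neq0 : (2%:R : K) != 0 by have /pcharf0P -> := charK0.
split=> [[leib nd symp] | [leib nd symp]].
  have lsa : left_symmetric_algebra (star_l mul omega).
    apply: (@left_symmetric_adjoint _ _ _ mul _ 1) => // [|a x y|u v|u v].
    - by rewrite mulr1.
    - exact: lmul_linear.
    - by rewrite scale1r leib.
    - by rewrite scale1r symp.
  (* The constant is 1, not 1/2: the symplectic condition equates [half_bracket] with the full
     commutator of the star product. *)
  split=> //; apply: (@lie_bracket_left_symmetric _ _ _ _ 1 lsa) => u v.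
  by rewrite scale1r -symp /star_l opprK addrC.
have lsa : left_symmetric_algebra (star_r mul omega).
  (* The right Leibniz and right symplectic identities both carry a minus sign, hence [e = -1]. *)
  apply: (@left_symmetric_adjoint _ _ _ mul _ (-1)) => // [|a x y|u v|u v].
  - by rewrite mulrNN mulr1.
  - exact: rmul_linear.
  - by rewrite scaleN1r leib.
  - by rewrite scaleN1r symp.
split=> //; apply: (@lie_bracket_left_symmetric _ _ _ _ (-1) lsa) => u v.
by rewrite scaleN1r -[LHS]opprK -symp /star_r opprK [- _ + _ in RHS]addrC.
Qed.
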